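(* Let $\sigma = (\lambda_1,\lambda_2,\lambda_3,\lambda_4,\lambda_5)$ be a list of real numbers such that (i) $e_1(\sigma) = \lambda_1+\lambda_2+\lambda_3+\lambda_4+\lambda_5 \ge 0$; (ii) $\lambda_1 \ge \lambda_2 \ge \lambda_3 \ge \lambda_4 \ge \lambda_5 > -\lambda_1$; (iii) $\lambda_3 > e_1(\sigma)$; (iv) $r(\sigma) \ge 0$. Then the matrix $A(\sigma)$ is well defined and (entrywise) nonnegative, and so $\sigma$ is realizable by a $5\times 5$ nonnegative symmetric matrix.
   Context: For a list $\sigma=(\lambda_1,\dots,\lambda_5)$ let $e_n = e_n(\sigma)=\sum_{1\le j_1<\dots<j_n\le 5}\prod_{i=1}^n \lambda_{j_i}$ ($n=1,\dots,5$) be the elementary symmetric functions, and define $$u = u(\sigma) = -e_2(\sigma)-\lambda_2^2-\lambda_5^2,$$ $$v = v(\sigma) = -(\lambda_3+\lambda_5)(\lambda_4+\lambda_5)(\lambda_2+\lambda_4)(\lambda_2+\lambda_3)(\lambda_1+\lambda_2)(\lambda_1+\lambda_5),$$ $$w = w(\sigma) = \lambda_2\lambda_5 e_1(\sigma)-\lambda_1\lambda_3\lambda_4,\qquad r = r(\sigma) = e_3(\sigma)+e_1(\sigma)(\lambda_2^2+\lambda_5^2).$$ The matrix $A(\sigma)$ is defined when $u\neq 0$ by $$A(\sigma)=\frac{1}{2u}\begin{pmatrix} 2ue_1&0&\sqrt{2u^3}&0&\sqrt{2u^3}\\ 0&0&0&2w&2\sqrt{v}\\ \sqrt{2u^3}&0&0&2\sqrt{v}&2r\\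 0&2w&2\sqrt{v}&0&0\\ \sqrt{2u^3}&2\sqrt{v}&2r&0&0\end{pmatrix},$$ where $\sqrt{\cdot}$ is the principal square root: for $z=\varrho\, e^{i\varphi}$ with $\varrho\ge 0$, $-\pi<\varphi\le\pi$, $\sqrt z=\sqrt{\varrho}\,e^{i\varphi/2}$. A matrix is nonnegative if all its entries are nonnegative real numbers. A list $\sigma$ is realizable by a matrix if it is the spectrum of that matrix (eigenvalues counted with multiplicity). *)

(* Defs.v *)
From HB Require Import structures.
From mathcomp Require Import all_boot all_order all_algebra.
From mathcomp Require Import complex.
From mathcomp Require Import reals trigo.
From mathcomp Require Import ring lra.

Set Implicit Arguments.
Unset Strict Implicit.
Unset Printing Implicit Defensive.
Import Order.TTheory GRing.Theory Num.Theory.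
Local Open Scope ring_scope.
Local Open Scope complex_scope.

(* The square root used below is [sqrtc]. This lemma shows that it is the
   principal one (in contrast to [sqrtC], which has nonnegative imaginary
   part): sqrt (rho e^(i phi)) = sqrt rho e^(i phi / 2) for -pi < phi <= pi. *)
Lemma sqrtc_principal (R : realType) (rho phi : R) :
  0 <= rho -> - pi < phi -> phi <= pi ->
  sqrtc (rho%:C * (cos phi +i* sin phi)) =
  (Num.sqrt rho)%:C * (cos (phi / 2) +i* sin (phi / 2)).
Proof.
move=> rho0 phi_gt phi_le.
pose t := phi / 2; have tE : phi = t *+ 2 by rewrite /t; lra.
have pi0 := pi_gt0 R.
have ct : 0 <= cos t by apply: cos_ge0_pihalf; rewrite /t; lra.
have mulE (a b c : R) : a%:C * (b +i* c) = (a * b) +i* (a * c) by simpc.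
have sinE : sin phi = 2 * (sin t * cos t).
  by rewrite tE mulr2n sinD; ring.
have cs : cos t ^+ 2 + sin t ^+ 2 = 1 by exact: cos2Dsin2.
have rE : Num.sqrt ((rho * cos phi) ^+ 2 + (rho * sin phi) ^+ 2) = rho.
  by rewrite !exprMn -mulrDr cos2Dsin2 mulr1 sqrtr_sqr ger0_norm.
have r1 : (rho + rho * cos phi) / 2 = rho * cos t ^+ 2.
  by rewrite tE cos_mulr2n; lra.
have r2 : (rho - rho * cos phi) / 2 = rho * sin t ^+ 2.
  by rewrite tE cos_mulr2n; nra.
rewrite !mulE /sqrtc rE r1 r2 !(sqrtrM _ rho0) !sqrtr_sqr (ger0_norm ct).
congr (_ +i* _); rewrite -/t mulrCA.
have [->|rho_neq0] := eqVneq rho 0; first by rewrite sqrtr0 !mul0r.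
have {rho_neq0} rho_gt0 : 0 < rho by rewrite lt_def rho_neq0.
congr (_ * _); rewrite sinE.
have [t0|t0] := leP 0 t.
  have st : 0 <= sin t by apply: sin_ge0_pi; rewrite /t in t0 *; lra.
  rewrite ger0_norm //; case: eqP => [_|/eqP h]; first by rewrite mul1r.
  rewrite gtr0_sg ?mul1r // lt_def h /=.
  by rewrite mulr_ge0 ?mulr_ge0 // ltW.
have st : sin t < 0.
  rewrite -[t]opprK sinN oppr_lt0; apply: sin_gt0_pi.
  by rewrite /t in t0 *; lra.
have ct' : 0 < cos t by apply: cos_gt0_pihalf; rewrite /t in t0 *; lra.
have neg : rho * (2 * (sin t * cos t)) < 0.
  by rewrite pmulr_rlt0 // pmulr_rlt0 // pmulr_llt0.
by rewrite (lt_eqF neg) ltr0_sg // ltr0_norm // mulN1r opprK.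
Qed.

Definition elem_sym (R : comNzRingType) (m n : nat) (s : m.-tuple R) : R :=
  \sum_(J : {set 'I_m} | #|J| == n) \prod_(j in J) tnth s j.

(* 1-based indexing, for 1 <= i <= 5. *)
Definition lam (R : realType) (s : 5.-tuple R) (i : nat) : R := s`_i.-1.

Definition uA (R : realType) (s : 5.-tuple R) : R :=
  - elem_sym 2 s - lam s 2 ^+ 2 - lam s 5 ^+ 2.

Definition vA (R : realType) (s : 5.-tuple R) : R :=
  - ((lam s 3 + lam s 5) * (lam s 4 + lam s 5) * (lam s 2 + lam s 4) *
     (lam s 2 + lam s 3) * (lam s 1 + lam s 2) * (lam s 1 + lam s 5)).

Definition wA (R : realType) (s : 5.-tuple R) : R :=
  lam s 2 * lam s 5 * elem_sym 1 s - lam s 1 * lam s 3 * lam s 4.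

Definition rA (R : realType) (s : 5.-tuple R) : R :=
  elem_sym 3 s + elem_sym 1 s * (lam s 2 ^+ 2 + lam s 5 ^+ 2).

(* The entries are complex because the radicands may be negative for a general
   list. The matrix is meaningful only when [uA s != 0]. *)
Definition matA (R : realType) (s : 5.-tuple R) : 'M[R[i]]_5 :=
  let a := sqrtc (2 * uA s ^+ 3)%:C in
  let b := 2 * sqrtc (vA s)%:C in
  let c := (2 * uA s * elem_sym 1 s)%:C in
  let p := (2 * wA s)%:C in
  let q := (2 * rA s)%:C in
  ((2 * uA s)%:C)^-1 *:
  \matrix_(i < 5, j < 5)
    nth 0 (nth [::] [:: [:: c; 0; a; 0; a];
                        [:: 0; 0; 0; p; b];
                        [:: a; 0; 0; b; q];
                        [:: 0; p; b; 0; 0];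
                        [:: a; b; q; 0; 0]] i) j.

(* Over R[i], [0 <= z] says that z is real and nonnegative. *)
Definition nonneg_mx (F : numDomainType) (m n : nat) (M : 'M[F]_(m, n)) : Prop :=
  forall i j, 0 <= M i j.

(* [s] lists the eigenvalues of [M] with their algebraic multiplicities. *)
Definition is_spectrum (F : comNzRingType) (n : nat) (M : 'M[F]_n) (s : seq F) :
  Prop := char_poly M = \prod_(x <- s) ('X - x%:P).

(* Main.v *)
Require Import Defs.
From mathcomp Require Import all_boot all_order all_algebra.
From mathcomp Require Import complex.
From mathcomp Require Import reals.
From mathcomp Require Import ring lra.
Import Order.TTheory GRing.Theory Num.Theory.
Local Open Scope ring_scope.

(* The lower right 4x4 block of [matA sigma] pairs the indices {2, 3} with
   {4, 5} through a symmetric matrix of determinant [lam 2 * lam 5] and sum of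
   squares of entries [lam 2 ^+ 2 + lam 5 ^+ 2], so its eigenvalues are
   +- [lam 2], +- [lam 5]. Bordering it by the first row and column adjusts the
   coefficients of the characteristic polynomial to those of
   [\prod_i ('X - lam i)]; [sqrtc vA] enters these only through its square.
   For the signs: [- lam 1 < lam 5] and [e1 < lam 3] force
   [lam 4 < - lam 2]. *)

(** When the product is expanded, [J] collects the factors that contribute [x%:P * 'X]. Unlike the
    sum over subsets, this form can be evaluated one list element at a time. *)
Lemma elem_sym_coef (R : comNzRingType) (m n : nat) (s : m.-tuple R) :
  elem_sym n s = (\prod_(x <- s) (1 + x%:P * 'X))`_n.
Proof.
rewrite big_tuple; under eq_bigr => i _ do rewrite addrC.
rewrite bigA_distr coef_sum /elem_sym big_mkcond; apply: eq_bigr => J _.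
rewrite -big_mkcond big_split prodr_const /= -rmorph_prod coefCM coefXn.
by rewrite eq_sym; case: ifP; rewrite ?mulr1 ?mulr0.
Qed.

Lemma tuple5E (T : Type) (s : 5.-tuple T) :
  exists a b c d e, s = [tuple a; b; c; d; e].
Proof.
case: s => -[|a [|b [|c [|d [|e [|]]]]]] //= hs.
by exists a, b, c, d, e; apply: val_inj.
Qed.

Lemma elem_sym5 (R : comNzRingType) (a b c d e : R) :
  let s := [tuple a; b; c; d; e] in
  [/\ elem_sym 1 s = a + b + c + d + e,
      elem_sym 2 s =
        a * (b + c + d + e) + b * (c + d + e) + c * (d + e) + d * e
    & elem_sym 3 s =
        a * (b * (c + d + e) + c * (d + e) + d * e) +
        b * (c * (d + e) + d * e) + c * d * e].
Proof.
have recE (x : R) (p : {poly R}) n :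
    ((1 + x%:P * 'X) * p)`_n = p`_n + (if n is k.+1 then x * p`_k else 0).
  rewrite mulrDl mul1r coefD -mulrA coefCM coefXM.
  by case: n => [|n] /=; rewrite ?mulr0.
by split; rewrite elem_sym_coef /= !big_cons big_nil !recE !coef1 /=; ring.
Qed.

(* Indexing by [nat] instead of ordinals lets the expansion compute. *)
Fixpoint laplace {R : comNzRingType} (n : nat) (F : nat -> nat -> R) : R :=
  if n is n'.+1 then
    foldr (fun j acc =>
      (-1) ^+ j * F 0%N j * laplace n' (fun i k => F i.+1 (bump j k)) + acc)
      0 (iota 0 n)
  else 1.

Lemma det_laplace (R : comNzRingType) (n : nat) (F : nat -> nat -> R) :
  \det (\matrix_(i < n, j < n) F i j) = laplace n F.
Proof.
elim: n F => [|n IHn] F; first by rewrite det_mx00.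
pose G j := (-1) ^+ j * F 0%N j * laplace n (fun i k => F i.+1 (bump j k)).
have -> : laplace n.+1 F = \sum_(j <- iota 0 n.+1) G j by rewrite unlock.
rewrite -[iota _ _]/(index_iota 0 n.+1) big_mkord.
rewrite (expand_det_row _ ord0); apply: eq_bigr => j _.
rewrite mxE /cofactor add0n mulrCA mulrA /G -IHn; congr (_ * \det _).
by apply/matrixP => i k; rewrite !mxE.
Qed.

Definition pattern_mx {F : nmodType} (s p w q r : F) : 'M[F]_5 :=
  \matrix_(i < 5, j < 5)
    nth 0 (nth [::] [:: [:: s; 0; p; 0; p];
                        [:: 0; 0; 0; w; q];
                        [:: p; 0; 0; q; r];
                        [:: 0; w; q; 0; 0];
                        [:: p; q; r; 0; 0]] i) j.

(** The cofactor of ['X - s%:P] is the characteristic polynomial of the lower block with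
    off-diagonal part [[[w, q], [q, r]]]; the terms in [p ^+ 2] come from the border. *)
Lemma char_poly_pattern_mx (R : comNzRingType) (s p w q r : R) :
  char_poly (pattern_mx s p w q r) =
  ('X - s%:P) *
    ('X^4 - (w ^+ 2 + 2 * q ^+ 2 + r ^+ 2)%:P * 'X^2
     + ((w * r - q ^+ 2) ^+ 2)%:P)
  - (2 * p ^+ 2)%:P * 'X^3
  - (2 * p ^+ 2 * r)%:P * 'X^2
  + (2 * p ^+ 2 * (w ^+ 2 + q ^+ 2))%:P * 'X
  + (2 * p ^+ 2 * w * (w * r - q ^+ 2))%:P.
Proof.
pose G (i j : nat) : {poly R} := nth 0 (nth [::]
  [:: [:: 'X - s%:P; 0; - p%:P; 0; - p%:P];
      [:: 0; 'X; 0; - w%:P; - q%:P];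
      [:: - p%:P; 0; 'X; - q%:P; - r%:P];
      [:: 0; - w%:P; - q%:P; 'X; 0];
      [:: - p%:P; - q%:P; - r%:P; 0; 'X]] i) j.
have -> : char_poly (pattern_mx s p w q r) =
    \det (\matrix_(i < 5, j < 5) G i j).
  congr (\det _); apply/matrixP => -[i hi] [j hj]; rewrite !mxE.
  by case: i hi => [|[|[|[|[|]]]]] // hi; case: j hj => [|[|[|[|[|]]]]] // hj;
    rewrite /G /= ?mulr0n ?mulr1n ?subr0 ?sub0r ?polyC0 ?subr0 ?oppr0.
by rewrite det_laplace /G /=; ring.
Qed.

Lemma map_pattern_mx (F G : nmodType) (f : {additive F -> G}) (s p w q r : F) :
  map_mx f (pattern_mx s p w q r) = pattern_mx (f s) (f p) (f w) (f q) (f r).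
Proof.
apply/matrixP => -[i hi] [j hj]; rewrite !mxE.
by case: i hi => [|[|[|[|[|]]]]] // hi; case: j hj => [|[|[|[|[|]]]]] // hj;
  rewrite /= ?raddf0.
Qed.

Lemma pattern_mx_nonneg (F : numDomainType) (s p w q r : F) :
  0 <= s -> 0 <= p -> 0 <= w -> 0 <= q -> 0 <= r ->
  nonneg_mx (pattern_mx s p w q r).
Proof.
move=> s0 p0 w0 q0 r0 [i hi] [j hj]; rewrite mxE.
by case: i hi => [|[|[|[|[|]]]]] // hi; case: j hj => [|[|[|[|[|]]]]] // hj.
Qed.

Lemma tr_pattern_mx (F : nmodType) (s p w q r : F) :
  (pattern_mx s p w q r)^T = pattern_mx s p w q r.
Proof.
apply/matrixP => -[i hi] [j hj]; rewrite !mxE.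
by case: i hi => [|[|[|[|[|]]]]] // hi; case: j hj => [|[|[|[|[|]]]]] // hj.
Qed.

Lemma uvwA_sign (R : realType) (sigma : 5.-tuple R) :
  0 <= elem_sym 1 sigma ->
  lam sigma 2 <= lam sigma 1 -> lam sigma 3 <= lam sigma 2 ->
  lam sigma 4 <= lam sigma 3 -> lam sigma 5 <= lam sigma 4 ->
  - lam sigma 1 < lam sigma 5 -> elem_sym 1 sigma < lam sigma 3 ->
  [/\ 0 < uA sigma, 0 <= vA sigma & 0 <= wA sigma].
Proof.
case: (tuple5E _ sigma) => a [b [c [d [e ->]]]].
rewrite /uA /vA /wA; have [-> -> _] := elem_sym5 _ a b c d e.
rewrite /lam /= => s0 ab bc cd de ae sc.
have d_lt_b : d < - b by lra.
split.
(* Since [e1 ^+ 2] is the sum of squares plus [2 * e2], the three products add up to [2 * u]. *)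
- have H1 : 0 < (a - e) * (a + e) by apply: mulr_gt0; lra.
  have H2 : 0 < (b - d) * (- d - b) by apply: mulr_gt0; lra.
  have H3 : 0 < (c - (a + b + c + d + e)) * (c + (a + b + c + d + e)).
    by apply: mulr_gt0; lra.
  lra.
(* The three negative factors absorb the leading sign. *)
- have -> : - ((c + e) * (d + e) * (b + d) * (b + c) * (a + b) * (a + e)) =
    (- c - e) * (- d - e) * (- b - d) * (b + c) * (a + b) * (a + e) by ring.
  by rewrite !mulr_ge0; lra.
(* The factors are ordered for termwise comparison: [b <= - d], [- e <= a], [e1 <= c]. *)
have H : b * - e * (a + b + c + d + e) <= (- d) * a * c.
  by rewrite !ler_pM ?mulr_ge0; lra.
lra.
Qed.

(** Divided by [u ^+ 2], the first two give the sum of squares and the determinant of the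
    off-diagonal block. The third, divided by [u], makes the border contribute
    [e4 - b ^+ 2 * e ^+ 2] to the coefficient of ['X]. *)
Lemma uvwrA_identities (R : realType) (a b c d e : R) :
  let s := [tuple a; b; c; d; e] in
  let u := uA s in let v := vA s in let w := wA s in let r := rA s in
  [/\ w ^+ 2 + 2 * v + r ^+ 2 = (b ^+ 2 + e ^+ 2) * u ^+ 2,
      w * r - v = b * e * u ^+ 2
    & w ^+ 2 + v = u * (a * b * c * d + a * b * c * e + a * b * d * e
                        + a * c * d * e + b * c * d * e - b ^+ 2 * e ^+ 2)].
Proof.
rewrite /= /uA /vA /wA /rA; have [-> -> ->] := elem_sym5 _ a b c d e.
by rewrite /lam /=; split; ring.
Qed.

Theorem lemma5 (R : realType) (sigma : 5.-tuple R)
    (e1_ge0 : 0 <= elem_sym 1 sigma)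
    (lam_ge12 : lam sigma 1 >= lam sigma 2)
    (lam_ge23 : lam sigma 2 >= lam sigma 3)
    (lam_ge34 : lam sigma 3 >= lam sigma 4)
    (lam_ge45 : lam sigma 4 >= lam sigma 5)
    (lam5_gt : lam sigma 5 > - lam sigma 1)
    (lam3_gt : lam sigma 3 > elem_sym 1 sigma)
    (r_ge0 : rA sigma >= 0) :
  [/\ uA sigma != 0,
      nonneg_mx (matA sigma)
    & exists M : 'M[R]_5,
        [/\ nonneg_mx M, M^T = M & is_spectrum M sigma]].
Proof.
have [u0 v0 w0] := uvwA_sign _ _ e1_ge0 lam_ge12 lam_ge23 lam_ge34 lam_ge45
  lam5_gt lam3_gt.
have [b0 e0] : 0 <= 2 * uA sigma ^+ 3 /\ 0 <= (2 * uA sigma)^-1.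
  by split; rewrite ?invr_ge0 mulr_ge0 ?exprn_ge0 // ltW.
pose k := (2 * uA sigma)^-1.
pose p := k * Num.sqrt (2 * uA sigma ^+ 3).
pose q := k * (2 * Num.sqrt (vA sigma)).
(* Both radicands are nonnegative, so [sqrtc] agrees with the real root and [matA sigma] is the
   image of this real matrix. *)
pose M := pattern_mx (k * (2 * uA sigma * elem_sym 1 sigma)) p
  (k * (2 * wA sigma)) q (k * (2 * rA sigma)).
have M_ge0 : nonneg_mx M.
  by apply: pattern_mx_nonneg; rewrite ?mulr_ge0 ?sqrtr_ge0 // ltW.
split; first by rewrite gt_eqF.
  suff -> : matA sigma = map_mx (real_complex R) M.
    by move=> i j; rewrite mxE ler0c; apply: M_ge0.
  rewrite map_pattern_mx /matA !sqrtc_sqrtr ?ler0c //=.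
  apply/matrixP => -[i hi] [j hj]; rewrite !mxE.
  by case: i hi => [|[|[|[|[|]]]]] // hi; case: j hj => [|[|[|[|[|]]]]] // hj;
    rewrite /= ?mulr0 // -?fmorphV /p /q /k !rmorphM ?rmorph_nat.
exists M; split => //; first exact: tr_pattern_mx.
have un0 : uA sigma != 0 by rewrite gt_eqF.
have kE x : k * (2 * x) = x / uA sigma by rewrite /k; field.
have kp : 2 * p ^+ 2 = uA sigma by rewrite exprMn sqr_sqrtr // /k; field.
have kq : q ^+ 2 = vA sigma / uA sigma ^+ 2.
  by rewrite !exprMn sqr_sqrtr // /k; field.
rewrite /is_spectrum char_poly_pattern_mx kp kq.
rewrite -(mulrA 2) !kE {M M_ge0 kE k p q kp kq}.
case: (tuple5E _ sigma) un0 => a [b [c [d [e ->]]]].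
set s := [tuple _; _; _; _; _] => un0.
have [tr_sq offdet wv] := uvwrA_identities _ a b c d e.
have cancel x : uA s * (x / uA s) = x by field.
have -> : (wA s / uA s) ^+ 2 + 2 * (vA s / uA s ^+ 2) + (rA s / uA s) ^+ 2
    = b ^+ 2 + e ^+ 2.
  by apply: (mulIf (expf_neq0 2 un0)); rewrite -tr_sq; field.
have -> : wA s / uA s * (rA s / uA s) - vA s / uA s ^+ 2 = b * e.
  by apply: (mulIf (expf_neq0 2 un0)); rewrite -offdet; field.
have -> : uA s * ((wA s / uA s) ^+ 2 + vA s / uA s ^+ 2) =
    (wA s ^+ 2 + vA s) / uA s.
  by field.
(* What remains is a comparison of coefficients; for instance, the constant term is [b * e * (w - b
   * e * e1) = - (a * b * c * d * e)]. *)
rewrite !cancel wv -!(mulrA (uA s)) !cancel /uA /wA /rA.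
have [-> -> ->] := elem_sym5 _ a b c d e.
by rewrite /lam /= !big_cons big_nil; ring.
Qed.
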